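(* Consider a convex multiobjective optimization problem $\min (f_1(x),\dots,f_m(x))$ subject to $c_1(x)\ge 0,\dots,c_l(x)\ge 0$ in $x\in\mathbb{R}^n$, where all $f_j$ are convex real polynomials and all $c_i$ are concave real polynomials. Let $\mathcal{WP}$ be its weakly Pareto set, and assume a constraint qualification holds (see context). Suppose that the $(n+1)\times m$ matrix polynomial $$Q(x)=\begin{bmatrix}\nabla f_1(x)&\cdots&\nabla f_m(x)\\ 1&\cdots&1\end{bmatrix}$$ is nonsingular, i.e. $\operatorname{rank}Q(x)=m$ for all $x\in\mathbb{C}^n$. Let $Q'(x)\in\mathbb{R}[x]^{m\times(n+1)}$ be a matrix polynomial with $Q'(x)Q(x)=I_m$, let $Q_1'(x)$ be the submatrix formed by its first $n$ columns and $Q_2'(x)$ its $(n+1)$th column, and put $$w(x,\lambda)=(w_1(x,\lambda),\dots,w_m(x,\lambda))=\sum_{i=1}^l\lambda_i\,Q_1'(x)\nabla c_i(x)+Q_2'(x).$$ Then $\mathcal{WP}$ equals the set of all $x\in\mathbb{R}^n$ for which there exists $\lambda=(\lambda_1,\dots,\lambda_l)\in\mathbb{R}^l$ such that $$\sum_{j=1}^m w_j(x,\lambda)\nabla f_j(x)=\sum_{i=1}^l\lambda_i\nabla c_i(x),$$ $$c_i(x)\ge 0,\quad\lambda_i\ge 0,\quad \lambda_i c_i(x)=0\quad(i=1,\dots,l),$$ $$w_1(x,\lambda)\ge 0,\dots,w_m(x,\lambda)\ge 0,\quad w_1(x,\lambda)+\cdots+w_m(x,\lambda)=1.$$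
   Context: Let $K=\{x\in\mathbb{R}^n: c_1(x)\ge 0,\dots,c_l(x)\ge 0\}$. A point $x^*\in K$ is a weakly Pareto point if there is no $x\in K$ with $f_i(x)<f_i(x^* )$ for all $i=1,\dots,m$; the weakly Pareto set $\mathcal{WP}$ is the set of all weakly Pareto points. ''A constraint qualification holds'' means that some standard constraint qualification (e.g. the linear independence constraint qualification at every point of $K$, or Slater's condition) holds for $K$, which guarantees: for every $w\in\mathbb{R}^m$ with $w\ge 0$, $\sum_j w_j=1$, every minimizer $x$ of $\sum_j w_jf_j$ over $K$ admits Lagrange multipliers $\lambda\in\mathbb{R}^l$ with $\sum_j w_j\nabla f_j(x)=\sum_i\lambda_i\nabla c_i(x)$, $\lambda_i\ge 0$ and $\lambda_ic_i(x)=0$ for all $i$. When $Q(x)$ is nonsingular, a matrix polynomial $Q'(x)$ with $Q'(x)Q(x)=I_m$ exists. *)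

(* Defs.v *)
From HB Require Import structures.
From mathcomp Require Import all_boot all_order all_algebra.
From mathcomp Require Import complex.
From mathcomp Require Import boolp classical_sets reals convex.
(* Some notations of mpoly clash with those of MathComp-Analysis. *)
From mathcomp Require Import -(notations) mpoly.

Set Implicit Arguments.
Unset Strict Implicit.
Unset Printing Implicit Defensive.

Import Order.TTheory GRing.Theory Num.Theory.

Local Open Scope classical_set_scope.
Local Open Scope ring_scope.

Definition peval (S : comNzRingType) (n : nat) (x : 'cV[S]_n)
    (p : mpoly n S) : S :=
  meval (fun i => x i 0) p.

Definition mxeval (S : comNzRingType) (n r s : nat) (x : 'cV[S]_n)
    (A : 'M[mpoly n S]_(r, s)) : 'M[S]_(r, s) :=
  map_mx (peval x) A.

Definition grad (S : comNzRingType) (n : nat) (p : mpoly n S) :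
    'cV[mpoly n S]_n :=
  \col_(i < n) mderiv i p.

Definition complexify (R : realType) (n r s : nat)
    (A : 'M[mpoly n R]_(r, s)) : 'M[mpoly n R[i]]_(r, s) :=
  map_mx (map_mpoly (real_complex R)) A.

Definition convex_poly (R : realType) (n : nat) (p : mpoly n R) : Prop :=
  convex_function [set: 'cV[R]_n] (fun x : 'cV[R]_n => peval x p : R^o).

Definition concave_poly (R : realType) (n : nat) (p : mpoly n R) : Prop :=
  convex_function [set: 'cV[R]_n] (fun x : 'cV[R]_n => - peval x p : R^o).

Definition feasible (R : realType) (n l : nat) (c : 'I_l -> mpoly n R) :
    set 'cV[R]_n :=
  [set x | forall i, 0 <= peval x (c i)].

Definition weakly_pareto (R : realType) (n m l : nat)
    (f : 'I_m -> mpoly n R) (c : 'I_l -> mpoly n R) : set 'cV[R]_n :=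
  [set x | feasible c x /\
     ~ exists y, feasible c y /\ forall j, peval y (f j) < peval x (f j)].

Definition minimizer_on (R : realType) (n : nat) (K : set 'cV[R]_n)
    (g : 'cV[R]_n -> R) (x : 'cV[R]_n) : Prop :=
  K x /\ forall y, K y -> g x <= g y.

Definition weight (R : realType) (m : nat) (w : 'cV[R]_m) : Prop :=
  (forall j, 0 <= w j 0) /\ \sum_(j < m) w j 0 = 1.

Definition stationary (R : realType) (n m l : nat)
    (f : 'I_m -> mpoly n R) (c : 'I_l -> mpoly n R)
    (x : 'cV[R]_n) (w : 'cV[R]_m) (lam : 'cV[R]_l) : Prop :=
  \sum_(j < m) w j 0 *: mxeval x (grad (f j)) =
  \sum_(i < l) lam i 0 *: mxeval x (grad (c i)).

Definition LICQ (R : realType) (n l : nat) (c : 'I_l -> mpoly n R) : Prop :=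
  forall x, feasible c x ->
    free [seq mxeval x (grad (c i)) | i <- enum 'I_l & peval x (c i) == 0].

Definition slater (R : realType) (n l : nat) (c : 'I_l -> mpoly n R) : Prop :=
  exists x : 'cV[R]_n, forall i, 0 < peval x (c i).

Definition has_multipliers (R : realType) (n m l : nat)
    (f : 'I_m -> mpoly n R) (c : 'I_l -> mpoly n R) : Prop :=
  forall (w : 'cV[R]_m) (x : 'cV[R]_n),
    weight w ->
    minimizer_on (feasible c)
      (fun y => \sum_(j < m) w j 0 * peval y (f j)) x ->
    exists lam : 'cV[R]_l,
      stationary f c x w lam /\
      forall i, 0 <= lam i 0 /\ lam i 0 * peval x (c i) = 0.

(* The last disjunct stands for any other constraint qualification, through
   the existence of Lagrange multipliers that it guarantees. *)
Definition constraint_qualification (R : realType) (n m l : nat)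
    (f : 'I_m -> mpoly n R) (c : 'I_l -> mpoly n R) : Prop :=
  LICQ c \/ slater c \/ has_multipliers f c.

Definition Qmx (R : realType) (n m : nat) (f : 'I_m -> mpoly n R) :
    'M[mpoly n R]_(n + 1, m) :=
  col_mx (\matrix_(i < n, j < m) grad (f j) i 0) (const_mx 1).

Definition nonsingular_mxpoly (R : realType) (n r s : nat)
    (A : 'M[mpoly n R]_(r, s)) : Prop :=
  forall z : 'cV[R[i]]_n, \rank (mxeval z (complexify A)) = s.

Definition wvec (R : realType) (n m l : nat) (c : 'I_l -> mpoly n R)
    (Q' : 'M[mpoly n R]_(m, n + 1)) (x : 'cV[R]_n) (lam : 'cV[R]_l) :
    'cV[R]_m :=
  \sum_(i < l) lam i 0 *: (mxeval x (lsubmx Q') *m mxeval x (grad (c i))) +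
  mxeval x (rsubmx Q').

(* Main.v *)
Require Import Defs.
From HB Require Import structures.
From mathcomp Require Import all_boot all_order all_algebra.
From mathcomp Require Import complex.
From mathcomp Require Import boolp classical_sets reals convex.
From mathcomp Require Import -(notations) mpoly.
From mathcomp Require Import interval_inference ring lra.

(** Convex functions [g_1, .., g_m] with no common negativity point on a convex
    set admit weights [w] with [\sum_j w_j g_j >= 0] there (Fan, Glicksberg and
    Hoffman), by induction on [m] from the case of two functions.  Applied to
    [f_j - f_j(x)] on the feasible set, this turns a weakly Pareto point [x] into
    a minimizer of a weighted sum [F] of the objectives.  Applied to [F - F(x)] and
    the [- c_i] on the whole space, it yields Fritz John multipliers, and Slater's
    condition or LICQ forces the multiplier of [F] to be positive.  Conversely, a
    stationary point of a convex Lagrangian minimizes it globally.  Finally [Q']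
    recovers the weights, because stationarity and [\sum_j w_j = 1] say that
    [Q(x) w] is the column [(\sum_i lam_i grad c_i(x), 1)]. *)

Set Implicit Arguments.
Unset Strict Implicit.
Unset Printing Implicit Defensive.

Import Order.TTheory GRing.Theory Num.Theory.

Local Open Scope classical_set_scope.
Local Open Scope ring_scope.

(** * Theorem of the alternative for convex functions *)

Section ConvexAlternative.
Variables (R : realType) (V : lmodType R).
Implicit Types (K : set V) (g h : V -> R) (x y : V).

Lemma i01_of (s t : R) : 0 <= s -> 0 <= t -> s + t = 1 ->
  exists p : {i01 R}, p%:num = s.
Proof.
move=> s0 t0 st; have s1 : s <= 1 by lra.
by exists (Itv01 s0 s1).
Qed.

(** Two real weights with sum 1 replace the packed [{i01 R}] number, so that linear arithmetic
    applies. *)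
Lemma convex_functionP K g : convex_function K (g : V -> R^o) <->
  (forall x y (s t : R), K x -> K y -> 0 <= s -> 0 <= t -> s + t = 1 ->
    g (s *: x + t *: y) <= s * g x + t * g y).
Proof.
split=> [cg x y s t Kx Ky s0 t0 st|cg p x y /set_mem Kx /set_mem Ky].
  have [p ps] := i01_of s0 t0 st.
  have := cg p x y (mem_set Kx) (mem_set Ky).
  have -> : t = 1 - s by lra.
  by rewrite -ps.
have p1 : 0 <= 1 - p%:num by rewrite subr_ge0.
exact: cg x y p%:num (1 - p%:num) Kx Ky (ge0 p) p1 (subrKC _ _).
Qed.

Lemma convex_setP K : convex_set (K : set (convex_lmodType V)) <->
  (forall x y (s t : R), K x -> K y -> 0 <= s -> 0 <= t -> s + t = 1 ->
    K (s *: x + t *: y)).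
Proof.
split=> [cK x y s t Kx Ky s0 t0 st|cK x y p /set_mem Kx /set_mem Ky].
  have [p ps] := i01_of s0 t0 st.
  have := cK x y p (mem_set Kx) (mem_set Ky).
  have -> : t = 1 - s by lra.
  by rewrite -ps => /set_mem.
have p1 : 0 <= 1 - p%:num by rewrite subr_ge0.
exact/mem_set/(cK x y p%:num (1 - p%:num) Kx Ky (ge0 p) p1 (subrKC _ _)).
Qed.

Lemma convex_function_subset K K' g : K' `<=` K ->
  convex_function K (g : V -> R^o) -> convex_function K' (g : V -> R^o).
Proof.
by move=> KK' /convex_functionP cg; apply/convex_functionP => x y s t /KK' + /KK';
  apply: cg.
Qed.

Lemma convex_function_sum K (I : finType) (a : I -> R) (g : I -> V -> R) :
  (forall i, 0 <= a i) -> (forall i, convex_function K (g i : V -> R^o)) ->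
  convex_function K ((fun x => \sum_i a i * g i x) : V -> R^o).
Proof.
move=> a0 cg; apply/convex_functionP => x y s t Kx Ky s0 t0 st.
rewrite !mulr_sumr -big_split /=; apply: ler_sum => i _.
rewrite !(mulrCA _ (a i)) -mulrDr ler_wpM2l //.
by have /convex_functionP := cg i; apply.
Qed.

Lemma convex_set_sublevel K g :
  convex_set (K : set (convex_lmodType V)) -> convex_function K (g : V -> R^o) ->
  convex_set ([set x | K x /\ g x < 0] : set (convex_lmodType V)).
Proof.
move=> /convex_setP cK /convex_functionP cg.
apply/convex_setP => x y s t [Kx gx] [Ky gy] s0 t0 st; split; first exact: cK.
apply: le_lt_trans (cg _ _ _ _ Kx Ky s0 t0 st) _.
(* Strictness needs a positive weight on a negative value: it is [s], or [t = 1] when [s]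
   vanishes. *)
have [s_eq0|s_neq0] := eqVneq s 0.
  by move: st; rewrite s_eq0 mul0r !add0r => ->; rewrite mul1r.
have sp : 0 < s by rewrite lt_def s_neq0.
by rewrite ltr_wnDr ?nmulr_llt0 // mulr_ge0_le0 // ltW.
Qed.

(** Convexity with unnormalized weights and no division. The point [z] does not depend on [g], so
    two functions can be compared at the same point. *)
Lemma convex_pair K x y (a b : R) :
  convex_set (K : set (convex_lmodType V)) -> K x -> K y ->
  0 <= a -> 0 <= b -> 0 < a + b ->
  exists2 z, K z & forall g, convex_function K (g : V -> R^o) ->
    (a + b) * g z <= a * g x + b * g y.
Proof.
move=> /convex_setP cK Kx Ky a0 b0 ab0.
have s0 : 0 <= a / (a + b) by rewrite divr_ge0 // ltW.
have t0 : 0 <= b / (a + b) by rewrite divr_ge0 // ltW.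
have st : a / (a + b) + b / (a + b) = 1 by rewrite -mulrDl divff ?gt_eqF.
exists ((a / (a + b)) *: x + (b / (a + b)) *: y); first exact: cK.
move=> g /convex_functionP /(_ _ _ _ _ Kx Ky s0 t0 st).
rewrite -(ler_pM2l ab0) => /le_trans; apply.
by rewrite mulrDr !mulrA ![(a + b) * _]mulrC !mulfK ?gt_eqF.
Qed.

(* The multiplier is the infimum of the ratios [h / - g] over [g < 0]: convexity
   bounds each of them below by every ratio [- h / g] with [g > 0]. *)
Lemma convex_alternative2 K g h y0 :
  convex_set (K : set (convex_lmodType V)) ->
  convex_function K (g : V -> R^o) -> convex_function K (h : V -> R^o) ->
  K y0 -> g y0 < 0 -> (forall y, K y -> g y < 0 -> 0 <= h y) ->
  exists2 tau : R, 0 <= tau & forall y, K y -> 0 <= tau * g y + h y.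
Proof.
move=> cK cg ch Ky0 gy0 hN.
have h_ge0 y : K y -> g y <= 0 -> 0 <= h y.
  move=> Ky; rewrite le_eqVlt => /orP[/eqP gy|]; last exact: hN.
  rewrite leNgt; apply/negP => hy; have hy0 := hN _ Ky0 gy0.
  (* If [g y = 0] and [h y < 0], moving slightly from [y] towards [y0] makes [g] negative. The
     weight of [y] exceeds [h y0], which keeps [h] negative and contradicts [hN]. *)
  have [|||z Kz zP] := @convex_pair K y y0 (- h y + 2 * h y0) (- h y) cK Ky Ky0.
  - lra.
  - lra.
  - lra.
  have gz := zP g cg; have hz := zP h ch; rewrite gy mulr0 add0r in gz.
  have gz0 : g z < 0 by rewrite -(pmulr_rlt0 (x := - h y + 2 * h y0 - h y)); nra.
  have := hN z Kz gz0; nra.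
pose E := [set r : R | exists y, [/\ K y, g y < 0 & r = h y / - g y]].
have E_lb y : K y -> 0 < g y -> lbound E (- h y / g y).
  move=> Ky gy r [z [Kz gz ->]]; rewrite ler_pdivrMr // mulrAC ler_pdivlMr; last lra.
  (* These weights cancel the values of [g], so [g u <= 0] and [h_ge0] applies at [u]. *)
  have [|||u Ku uP] := @convex_pair K z y (g y) (- g z) cK Kz Ky.
  - lra.
  - lra.
  - lra.
  have gu := uP g cg; have hu := uP h ch.
  have gu0 : g u <= 0 by rewrite -(pmulr_rle0 (x := g y - g z)); nra.
  have hu0 := h_ge0 u Ku gu0.
  have : 0 <= (g y - g z) * h u by rewrite mulr_ge0 //; lra.
  nra.
have E0 : lbound E 0.
  by move=> r [z [Kz gz ->]]; rewrite divr_ge0 ?hN //; lra.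
have E_n0 : E !=set0 by exists (h y0 / - g y0), y0.
exists (inf E); first exact: lb_le_inf.
move=> y Ky; have [gy|gy|gy] := ltgtP (g y) 0.
- have : inf E <= h y / - g y by apply: ge_inf; [exists 0|exists y].
  rewrite ler_pdivlMr; last lra; lra.
- have := lb_le_inf E_n0 (E_lb y Ky gy); rewrite ler_pdivrMr //; lra.
- by rewrite gy mulr0 add0r h_ge0 // gy.
Qed.

Lemma convex_alternative m K (g : 'I_m -> V -> R) :
  convex_set (K : set (convex_lmodType V)) -> K !=set0 ->
  (forall j, convex_function K (g j : V -> R^o)) ->
  ~ (exists y, K y /\ forall j, g j y < 0) ->
  exists2 w : 'cV[R]_m, weight w &
    forall y, K y -> 0 <= \sum_j w j 0 * g j y.
Proof.
elim: m => [|m IHm] in K g *.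
  by move=> _ [y Ky] _ []; exists y; split=> // -[].
move=> cK K0 cg Ng.
pose K' := [set y | K y /\ g ord0 y < 0].
(* If the first function is never negative on [K], it takes all the weight. Otherwise the remaining
   ones have no common negativity point on [K'], and induction combines them into one function,
   nonnegative on [K']. *)
have [[y0 [Ky0 gy0]]|K'0] := pselect (K' !=set0); last first.
  exists (delta_mx ord0 0).
    split; first by move=> j; rewrite mxE ler0n.
    rewrite (bigD1 ord0) //= mxE !eqxx big1 ?addr0 // => j /negPf j0.
    by rewrite mxE j0.
  move=> y Ky; rewrite (bigD1 ord0) //= mxE !eqxx mul1r big1 ?addr0.
    by rewrite leNgt; apply/negP => gy; apply: K'0; exists y.
  by move=> j /negPf j0; rewrite mxE j0 mul0r.
have [||||w' [w'0 w'1] w'P] := IHm K' (fun j => g (lift ord0 j)).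
- exact: convex_set_sublevel.
- by exists y0.
- by move=> j; apply: convex_function_subset (cg _) => y [].
- case=> y [[Ky gy] gjy]; apply: Ng; exists y; split=> // j.
  by case: (unliftP ord0 j) => [k|] ->.
have [||||tau tau0 tauP] := @convex_alternative2 K (g ord0)
    (fun y => \sum_j w' j 0 * g (lift ord0 j) y) y0 cK (cg ord0).
- exact: convex_function_sum.
- exact: Ky0.
- exact: gy0.
- by move=> y Ky gy; apply: w'P.
have tau1 : 0 < 1 + tau by lra.
(* [tau] is put in front of [w']; the total is [1 + tau] because [w'] sums to 1. *)
exists ((1 + tau)^-1 *: \col_j (if unlift ord0 j is Some k then w' k 0 else tau)).
  split.
    move=> j; rewrite !mxE mulr_ge0 ?invr_ge0 ?(ltW tau1) //.
    by case: unliftP => [k|] _; rewrite ?w'0.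
  under eq_bigr do rewrite !mxE; rewrite -mulr_sumr big_ord_recl unlift_none.
  under eq_bigr do rewrite liftK.
  by rewrite w'1 [tau + 1]addrC mulVf ?gt_eqF.
move=> y Ky; under eq_bigr do rewrite !mxE -mulrA.
rewrite -mulr_sumr big_ord_recl unlift_none.
under eq_bigr do rewrite liftK.
by rewrite mulr_ge0 ?invr_ge0 ?tauP // ltW.
Qed.

End ConvexAlternative.

(** * First-order calculus of polynomials along lines *)

Section PolynomialsOnLines.
Variables (R : realType) (n : nat).
Implicit Types (p q : mpoly n R) (x y d : 'cV[R]_n).

Definition dirderiv x d p : R := \sum_i d i 0 * peval x (mderiv i p).

Lemma pevalM x p q : peval x (p * q) = peval x p * peval x q.
Proof. exact: mevalM. Qed.

Lemma pevalB x p q : peval x (p - q) = peval x p - peval x q.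
Proof. exact: mevalB. Qed.

Lemma peval_lincomb x (I : finType) (a : I -> R) (p : I -> mpoly n R) :
  peval x (\sum_i a i *: p i) = \sum_i a i * peval x (p i).
Proof. by rewrite /peval raddf_sum; apply: eq_bigr => i _; exact: mevalZ. Qed.

Lemma dirderivM x d p q :
  dirderiv x d (p * q) = dirderiv x d p * peval x q + peval x p * dirderiv x d q.
Proof.
rewrite /dirderiv mulr_suml mulr_sumr -big_split; apply: eq_bigr => i _ /=.
by rewrite mderivM /peval mevalD !mevalM; ring.
Qed.

Lemma dirderivD x d p q :
  dirderiv x d (p + q) = dirderiv x d p + dirderiv x d q.
Proof.
rewrite /dirderiv -big_split; apply: eq_bigr => i _ /=.
by rewrite mderivD /peval mevalD mulrDr.
Qed.

Lemma dirderivC x d a : dirderiv x d (mpolyC n a) = 0.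
Proof. by rewrite /dirderiv big1 // => i _; rewrite mderivC /peval meval0 mulr0. Qed.

Lemma dirderivX x d i : dirderiv x d (mpolyX R (mnm1 i)) = d i 0.
Proof.
rewrite /dirderiv (bigD1 i) //= mderivX mnm1E eqxx scale1r big1 => [|j /negPf ji].
  have -> : mnm_sub (mnm1 i) (mnm1 i) = mnm0 by apply/mnmP => k; rewrite mnmBE subnn mnm0E.
  by rewrite mpolyX0 /peval meval1 mulr1 addr0.
by rewrite mderivX mnm1E eq_sym ji scale0r /peval meval0 mulr0.
Qed.

(** An algebraic Taylor expansion: it holds for constants and variables and is preserved by sums and
    products, hence holds for every polynomial. *)
Lemma peval_line p x d : exists q : {poly R}, forall t,
  peval (x + t *: d) p = peval x p + t * dirderiv x d p + t ^+ 2 * q.[t].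
Proof.
pose P p := exists q : {poly R}, forall t,
  peval (x + t *: d) p = peval x p + t * dirderiv x d p + t ^+ 2 * q.[t].
have PC a : P (mpolyC n a).
  by exists 0 => t; rewrite dirderivC /peval !mevalC horner0 !mulr0 !addr0.
have PD u v : P u -> P v -> P (u + v).
  move=> [q1 q1P] [q2 q2P]; exists (q1 + q2) => t; rewrite hornerD dirderivD.
  by rewrite /peval !mevalD -!/(peval _ _) q1P q2P; ring.
have PM u v : P u -> P v -> P (u * v).
  move=> [q1 q1P] [q2 q2P].
  set a := peval x u in q1P; set b := peval x v in q2P.
  set a' := dirderiv x d u in q1P; set b' := dirderiv x d v in q2P.
  (* The terms of order at least two in the product of both expansions, divided by [t ^+ 2]. *)
  exists ((a' * b')%:P + a *: q2 + b *: q1 + 'X * (a' *: q2 + b' *: q1)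
          + 'X ^+ 2 * (q1 * q2)) => t.
  rewrite !pevalM dirderivM q1P q2P -/a -/b -/a' -/b'.
  by rewrite !(hornerD, hornerM, hornerZ, hornerC, hornerX, hornerXn); ring.
have PX i : P (mpolyX R (mnm1 i)).
  by exists 0 => t; rewrite dirderivX /peval !mevalXU !mxE horner0 mulr0 addr0.
rewrite -/(P p); elim/mpolyind: p => [|a m p _ _ Pp].
  by rewrite -mpolyC0; apply: PC.
apply: PD => //; rewrite -mul_mpolyC; apply: (PM) => //.
rewrite mpolyXE_id; elim/big_ind: _ => [|u v|i _]; [exact: PC|exact: PM|].
elim: (m i) => [|k IHk]; first by rewrite expr0; apply: PC.
by rewrite exprS; apply: PM.
Qed.

Lemma horner_bounded (q : {poly R}) :
  exists2 M, 0 <= M & forall t, `|t| <= 1 -> `|q.[t]| <= M.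
Proof.
elim/poly_ind: q => [|q c [M M0 qM]]; first by exists 0 => // t _; rewrite horner0 normr0.
exists (M + `|c|) => [|t t1]; first by rewrite addr_ge0.
rewrite hornerMXaddC (le_trans (ler_normD _ _)) // lerD2r normrM.
by rewrite -[M]mulr1 ler_pM // qM.
Qed.

Lemma dirderiv_ge p x d (b : R) :
  (forall t, 0 < t -> t <= 1 -> peval x p + t * b <= peval (x + t *: d) p) ->
  b <= dirderiv x d p.
Proof.
move=> pb; have [q qE] := peval_line p x d; have [M M0 qM] := horner_bounded q.
set D := dirderiv x d p in qE *; rewrite leNgt; apply/negP => Db.
(* Chosen so that [0 < t <= 1] and [t * M < b - D]: the remainder is too small to close the gap
   between [D] and [b]. *)
pose t := (b - D) / (b - D + M + 1).
have den : 0 < b - D + M + 1 by lra.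
have t0 : 0 < t by rewrite divr_gt0 // subr_gt0.
have t1 : t <= 1 by rewrite ler_pdivrMr //; lra.
have tden : t * (b - D + M + 1) = b - D by rewrite divfK ?gt_eqF.
have := pb t t0 t1; rewrite qE -addrA lerD2l expr2 -mulrA -mulrDr ler_pM2l //.
have : q.[t] <= M by rewrite (le_trans (ler_norm _)) // qM // ger0_norm // ltW.
nra.
Qed.

Lemma convex_polyP p : convex_poly p <->
  (forall x y (s t : R), 0 <= s -> 0 <= t -> s + t = 1 ->
    peval (s *: x + t *: y) p <= s * peval x p + t * peval y p).
Proof.
split=> [/convex_functionP cp x y s t|cp]; first exact: cp.
by apply/convex_functionP => x y s t _ _; apply: cp.
Qed.

Lemma convex_poly_gradient p x y : convex_poly p ->
  peval x p + dirderiv x (y - x) p <= peval y p.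
Proof.
move=> /convex_polyP cp.
(* [dirderiv_ge] only gives lower bounds, whereas the derivative of [p] must be bounded above; hence
   the passage to [- p]. *)
suff : - (peval y p - peval x p) <= dirderiv x (y - x) (- p).
  have -> : dirderiv x (y - x) (- p) = - dirderiv x (y - x) p.
    rewrite /dirderiv -sumrN; apply: eq_bigr => i _.
    by rewrite mderivN /peval mevalN mulrN.
  lra.
apply: dirderiv_ge => t t0 t1; rewrite /peval !mevalN -!/(peval _ _).
have := cp x y (1 - t) t; rewrite subr_ge0 t1 (ltW t0) subrK => /(_ isT isT erefl).
have -> : (1 - t) *: x + t *: y = x + t *: (y - x).
  by rewrite scalerBl scale1r scalerBr addrA addrAC.
lra.
Qed.

Lemma dirderivE x d p : dirderiv x d p = (d^T *m mxeval x (grad p)) 0 0.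
Proof. by rewrite mxE; apply: eq_bigr => i _; rewrite !mxE. Qed.

Lemma critical_minimizer p x : convex_poly p -> mxeval x (grad p) = 0 ->
  forall y, peval x p <= peval y p.
Proof.
move=> cp gp y; have := convex_poly_gradient x y cp.
by rewrite dirderivE gp mulmx0 mxE addr0.
Qed.

(** All directional derivatives at a minimizer are nonnegative; opposite coordinate directions make
    each partial derivative vanish. *)
Lemma minimizer_critical p x :
  (forall y, peval x p <= peval y p) -> mxeval x (grad p) = 0.
Proof.
move=> px; have D0 d : 0 <= dirderiv x d p.
  by apply: dirderiv_ge => t _ _; rewrite mulr0 addr0.
apply/matrixP => i j; rewrite ord1 !mxE.
have De : dirderiv x (delta_mx i 0) p = peval x (mderiv i p).
  rewrite /dirderiv (bigD1 i) //= mxE !eqxx mul1r big1 ?addr0 // => k /negPf ki.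
  by rewrite mxE ki mul0r.
have DN d : dirderiv x (- d) p = - dirderiv x d p.
  by rewrite !dirderivE linearN mulNmx mxE.
have := D0 (delta_mx i 0); have := D0 (- delta_mx i 0); rewrite DN De.
by rewrite oppr_ge0 => ? ?; apply/eqP; rewrite eq_le; apply/andP.
Qed.

Lemma gradB x p q :
  mxeval x (grad (p - q)) = mxeval x (grad p) - mxeval x (grad q).
Proof. by apply/matrixP => i j; rewrite !mxE mderivB pevalB. Qed.

Lemma grad_lincomb x (I : finType) (a : I -> R) (p : I -> mpoly n R) :
  mxeval x (grad (\sum_i a i *: p i)) = \sum_i a i *: mxeval x (grad (p i)).
Proof.
apply/matrixP => i j; rewrite !mxE summxE raddf_sum /peval raddf_sum.
by apply: eq_bigr => k _; rewrite !mxE /= mderivZ mevalZ.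
Qed.

End PolynomialsOnLines.

(** Translates [free], which indexes coefficients by positions in a sequence, to coefficients
    indexed by [I]. For LICQ, [P] selects the active constraints. *)
Lemma free_filter_coef (F : fieldType) (W : vectType F) (I : finType) (P : pred I)
    (v : I -> W) (a : I -> F) :
  free [seq v i | i <- enum I & P i] ->
  (forall i, ~~ P i -> a i = 0) -> \sum_i a i *: v i = 0 -> forall i, a i = 0.
Proof.
move=> fv aP av i; have [Pi|/aP //] := boolP (P i).
set s := [seq i <- enum I | P i] in fv.
have is_ : i \in s by rewrite mem_filter Pi mem_enum.
have /freeP : free (in_tuple [seq v i | i <- s]) by [].
have sz : size [seq v i | i <- s] = size s by rewrite size_map.
move=> /(_ (fun k => a (nth i s k))) H.
have ik : (index i s < size [seq v i | i <- s])%N by rewrite sz index_mem.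
have := H _ (Ordinal ik); rewrite /= nth_index //; apply.
rewrite -[RHS]av (bigID P) /= [X in _ + X]big1 ?addr0; last first.
  by move=> k /aP ->; rewrite scale0r.
rewrite -(big_mkord xpredT (fun k => a (nth i s k) *: [seq v i | i <- s]`_k)) sz.
have -> : \sum_(j | P j) a j *: v j = \sum_(j <- s) a j *: v j.
  by rewrite big_filter big_enum_cond.
rewrite (big_nth i).
rewrite big_nat [RHS]big_nat; apply: eq_bigr => k /andP[_ ks].
by rewrite (nth_map i).
Qed.

(** * Scalarization and Lagrange multipliers *)

Section LagrangeMultipliers.
Variables (R : realType) (n m l : nat).
Variables (f : 'I_m -> mpoly n R) (c : 'I_l -> mpoly n R).
Implicit Types (x y : 'cV[R]_n) (w : 'cV[R]_m) (lam : 'cV[R]_l).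
Hypothesis f_convex : forall j, convex_poly (f j).
Hypothesis c_concave : forall i, concave_poly (c i).

(** A polynomial rather than a function, so that [grad] and the convexity lemmas apply to it. *)
Definition lagrangian (w : 'cV[R]_m) (lam : 'cV[R]_l) : mpoly n R :=
  \sum_j w j 0 *: f j - \sum_i lam i 0 *: c i.

Lemma peval_lagrangian x w lam : peval x (lagrangian w lam) =
  \sum_j w j 0 * peval x (f j) - \sum_i lam i 0 * peval x (c i).
Proof. by rewrite pevalB !peval_lincomb. Qed.

Lemma stationaryP x w lam :
  stationary f c x w lam <-> mxeval x (grad (lagrangian w lam)) = 0.
Proof.
rewrite gradB !grad_lincomb; split=> [->|/eqP]; first by rewrite subrr.
by rewrite subr_eq0 => /eqP.
Qed.

Lemma feasible_convex : convex_set (feasible c : set (convex_lmodType 'cV[R]_n)).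
Proof.
apply/convex_setP => x y s t Kx Ky s0 t0 st i; rewrite -oppr_le0.
have /convex_functionP := c_concave i; move=> /(_ x y s t I I s0 t0 st) /le_trans; apply.
by rewrite !mulrN -opprD oppr_le0 addr_ge0 // mulr_ge0.
Qed.

Lemma lagrangian_convex w lam : (forall j, 0 <= w j 0) ->
  (forall i, 0 <= lam i 0) -> convex_poly (lagrangian w lam).
Proof.
move=> w0 lam0; apply/convex_polyP => x y s t s0 t0 st.
have /convex_functionP := convex_function_sum w0 f_convex.
move=> /(_ x y s t I I s0 t0 st).
have /convex_functionP := convex_function_sum lam0 c_concave.
move=> /(_ x y s t I I s0 t0 st).
rewrite !peval_lagrangian.
under eq_bigr do rewrite mulrN.
under [X in _ <= s * X + _ -> _]eq_bigr do rewrite mulrN.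
under [X in _ <= _ + t * X -> _]eq_bigr do rewrite mulrN.
rewrite !sumrN; lra.
Qed.

(** [x] minimizes the Lagrangian globally. Its constraint term vanishes at [x] by complementarity
    and is nonnegative at a feasible [y], so [y] cannot have a smaller weighted objective. *)
Lemma stationary_weakly_pareto x (w : 'cV[R]_m) (lam : 'cV[R]_l) :
  feasible c x -> weight w -> stationary f c x w lam ->
  (forall i, 0 <= lam i 0 /\ lam i 0 * peval x (c i) = 0) ->
  weakly_pareto f c x.
Proof.
move=> Kx [w0 w1] /stationaryP gL lamP; split=> // -[y [Ky fyx]].
have lam0 i : 0 <= lam i 0 by case: (lamP i).
have := critical_minimizer (lagrangian_convex w0 lam0) gL y.
rewrite !peval_lagrangian [X in _ - X <= _]big1 ?subr0; last by move=> i _; case: (lamP i).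
rewrite leNgt => /negP; apply; rewrite ltrBlDr ltr_wpDr //.
  by apply: sumr_ge0 => i _; rewrite mulr_ge0.
have [j wj] : exists j, 0 < w j 0.
  apply/not_existsP => wN; move: w1; rewrite big1 => [/esym/eqP|j _].
    by rewrite oner_eq0.
  by apply/eqP; rewrite eq_le w0 leNgt andbT; apply/negP.
rewrite [ltLHS](bigD1 j) //= [ltRHS](bigD1 j) //= ltr_leD ?ltr_pM2l //.
by apply: ler_sum => k _; rewrite ler_wpM2l // ltW.
Qed.

Lemma weakly_pareto_minimizer x : weakly_pareto f c x ->
  exists2 w : 'cV[R]_m, weight w &
    minimizer_on (feasible c) (fun y => \sum_j w j 0 * peval y (f j)) x.
Proof.
move=> [Kx xP].
have [||w ww wP] := @convex_alternative R 'cV[R]_n m (feasible c)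
    (fun j y => peval y (f j) - peval x (f j)) feasible_convex (ex_intro _ x Kx).
- move=> j; apply/convex_functionP => y z s t _ _ s0 t0 st.
  have /convex_polyP /(_ y z s t s0 t0 st) := f_convex j.
  have -> : t = 1 - s by lra.
  lra.
- case=> y [Ky yP]; apply: xP; exists y; split=> // j.
  by have := yP j; rewrite subr_lt0.
exists w => //; split=> // y /wP.
by under eq_bigr do rewrite mulrBr; rewrite sumrB subr_ge0.
Qed.

(** A common negativity point of [F - F(x)] and the [- c i] would be feasible and better than [x].
    The final inequality is kept beside stationarity because the Slater case evaluates it at the
    Slater point. *)
Lemma fritz_john (w : 'cV[R]_m) x : weight w ->
  minimizer_on (feasible c) (fun y => \sum_j w j 0 * peval y (f j)) x ->
  exists (mu0 : R) (mu : 'cV[R]_l),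
    [/\ 0 <= mu0, forall i, 0 <= mu i 0 /\ mu i 0 * peval x (c i) = 0,
        mu0 + \sum_i mu i 0 = 1, stationary f c x (mu0 *: w) mu
      & forall y, \sum_i mu i 0 * peval y (c i) <=
          mu0 * (\sum_j w j 0 * peval y (f j) - \sum_j w j 0 * peval x (f j))].
Proof.
move=> [w0 _] [Kx xmin].
pose F y := \sum_j w j 0 * peval y (f j).
pose g (k : 'I_l.+1) y : R :=
  if unlift ord0 k is Some i then - peval y (c i) else F y - F x.
have [||||u [u0 u1] uP] := @convex_alternative R 'cV[R]_n l.+1 setT g.
- by apply/convex_setP.
- by exists x.
- move=> k; rewrite /g; case: unliftP => [i|] _; first exact: c_concave.
  apply/convex_functionP => y z s t _ _ s0 t0 st.
  have /convex_functionP /(_ y z s t I I s0 t0 st) := convex_function_sum w0 f_convex.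
  rewrite -/(F _) -/(F y) -/(F z); have -> : t = 1 - s by lra.
  lra.
- case=> y [_ gy]; have Ky : feasible c y.
    by move=> i; have := gy (lift ord0 i); rewrite /g liftK oppr_lt0 => /ltW.
  by have := gy ord0; rewrite /g unlift_none subr_lt0 ltNge xmin.
pose mu := \col_i u (lift ord0 i) 0.
have muP y : \sum_i mu i 0 * peval y (c i) <= u ord0 0 * (F y - F x).
  have := uP y I; rewrite big_ord_recl /g unlift_none.
  under eq_bigr do rewrite liftK mulrN.
  rewrite sumrN subr_ge0; under [X in _ -> X <= _]eq_bigr do rewrite mxE.
  exact.
(* At [y = x] the inequality [muP] bounds a sum of nonnegative terms by 0. *)
have mux i : mu i 0 * peval x (c i) = 0.
  have mc0 k : true -> 0 <= mu k 0 * peval x (c k) by move=> _; rewrite mxE mulr_ge0.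
  apply: (psumr_eq0P mc0) => //; apply/eqP; rewrite eq_le sumr_ge0 // andbT.
  by have := muP x; rewrite subrr mulr0.
exists (u ord0 0), mu; split=> //.
- by move=> i; split; rewrite ?mux // mxE.
- by rewrite -u1 big_ord_recl; congr (_ + _); apply: eq_bigr => i _; rewrite mxE.
(* By [muP] and complementarity, [x] minimizes this Lagrangian over the whole space. *)
apply/stationaryP/minimizer_critical => y.
have LE z : peval z (lagrangian (u ord0 0 *: w) mu) =
    u ord0 0 * F z - \sum_i mu i 0 * peval z (c i).
  rewrite peval_lagrangian; congr (_ - _); rewrite mulr_sumr.
  by apply: eq_bigr => j _; rewrite mxE mulrA.
rewrite !LE [X in _ - X <= _]big1 // subr0; have := muP y; lra.
Qed.

(* Under either condition the multiplier [mu0] of the objective in [fritz_john]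
   cannot vanish. *)
Lemma constraint_qualification_multipliers :
  constraint_qualification f c -> has_multipliers f c.
Proof.
move=> cq w x ww xmin.
have [cq'|] : (LICQ c \/ slater c) \/ has_multipliers f c by case: cq; tauto.
  2: by apply.
have [mu0 [mu [mu0_ge0 muP mu1 muS muL]]] := fritz_john ww xmin.
have mu0_neq0 : mu0 != 0.
  apply/eqP => mu00; rewrite mu00 add0r in mu1.
  suff mu_eq0 i : mu i 0 = 0.
    by move: mu1; rewrite big1 // => /esym/eqP; rewrite oner_eq0.
  case: cq' => [licq|[z cz]].
    (* With [mu0 = 0], stationarity is a linear relation between constraint gradients, and
       complementarity removes the inactive ones. *)
    move: i; apply: (free_filter_coef (licq x xmin.1)) => [i ci|].
      by have [_ /eqP] := muP i; rewrite mulf_eq0 (negPf ci) orbF => /eqP.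
    by rewrite -muS mu00 big1 // => j _; rewrite scale0r mxE scale0r.
  (* With [mu0 = 0], [muL z] forces the nonnegative terms [mu k 0 * peval z (c k)] to vanish, while
     each [peval z (c k)] is positive. *)
  have mcz k : true -> 0 <= mu k 0 * peval z (c k).
    by move=> _; rewrite mulr_ge0 ?(ltW (cz k)) //; case: (muP k).
  have mz0 : \sum_k mu k 0 * peval z (c k) = 0.
    by apply/eqP; rewrite eq_le sumr_ge0 // andbT; have := muL z; rewrite mu00 mul0r.
  have /eqP := psumr_eq0P mcz mz0 (erefl true : xpredT i).
  by rewrite mulf_eq0 (gt_eqF (cz i)) orbF => /eqP.
exists (mu0^-1 *: mu); split.
  have -> : w = mu0^-1 *: (mu0 *: w) by rewrite scalerA mulVf // scale1r.
  rewrite /stationary.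
  under eq_bigr do rewrite mxE -scalerA.
  under [RHS]eq_bigr do rewrite mxE -scalerA.
  by rewrite -!scaler_sumr muS.
by move=> i; rewrite mxE -mulrA; have [? ->] := muP i; rewrite mulr0 mulr_ge0 ?invr_ge0.
Qed.

End LagrangeMultipliers.

(** * Recovery of the weights through the left inverse of [Qmx f] *)

Lemma mxeval_mul (R : realType) n r s q (x : 'cV[R]_n)
    (A : 'M[mpoly n R]_(r, s)) (B : 'M[mpoly n R]_(s, q)) :
  mxeval x (A *m B) = mxeval x A *m mxeval x B.
Proof. exact: (map_mxM (meval (fun i => x i 0))). Qed.

Lemma wvec_weight (R : realType) (n m l : nat)
    (f : 'I_m -> mpoly n R) (c : 'I_l -> mpoly n R) (Q' : 'M[mpoly n R]_(m, n + 1))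
    (x : 'cV[R]_n) (w : 'cV[R]_m) (lam : 'cV[R]_l) :
  Q' *m Qmx f = 1%:M -> \sum_j w j 0 = 1 -> stationary f c x w lam ->
  wvec c Q' x lam = w.
Proof.
move=> Q'K w1 wS.
have QK : mxeval x Q' *m mxeval x (Qmx f) = 1%:M.
  rewrite -mxeval_mul Q'K; apply/matrixP => i j; rewrite !mxE /peval.
  by case: eqP => _; rewrite ?meval1 ?meval0.
have Qw : mxeval x (Qmx f) *m w =
    col_mx (\sum_i lam i 0 *: mxeval x (grad (c i))) 1%:M.
  rewrite /mxeval map_col_mx mul_col_mx -wS; congr col_mx.
    apply/matrixP => i j; rewrite ord1 !mxE summxE; apply: eq_bigr => k _.
    by rewrite !mxE mulrC.
  apply/matrixP => i j; rewrite !ord1 !mxE -w1; apply: eq_bigr => k _.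
  by rewrite !mxE /peval meval1 mul1r.
(* Multiplying the column by [Q'] gives [w] back, and splitting [Q'] into its two column blocks
   gives the formula of [wvec]. *)
rewrite -[RHS]mul1mx -QK -mulmxA Qw -{2}[Q']hsubmxK /mxeval map_row_mx mul_row_col.
rewrite mulmx1 /wvec mulmx_sumr; congr (_ + _); apply: eq_bigr => i _.
by rewrite scalemxAr.
Qed.

Theorem mainTheorem2 (R : realType) (n m l : nat)
  (f : 'I_m -> mpoly n R) (c : 'I_l -> mpoly n R)
  (f_convex : forall j, convex_poly (f j))
  (c_concave : forall i, concave_poly (c i))
  (cq : constraint_qualification f c)
  (Q_nonsingular : nonsingular_mxpoly (Qmx f))
  (Q' : 'M[mpoly n R]_(m, n + 1))
  (Q'K : Q' *m Qmx f = 1%:M) :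
  weakly_pareto f c =
  [set x : 'cV[R]_n | exists lam : 'cV[R]_l,
     [/\ \sum_(j < m) wvec c Q' x lam j 0 *: mxeval x (grad (f j)) =
           \sum_(i < l) lam i 0 *: mxeval x (grad (c i)),
         forall i, [/\ 0 <= peval x (c i), 0 <= lam i 0
                     & lam i 0 * peval x (c i) = 0],
         forall j, 0 <= wvec c Q' x lam j 0
       & \sum_(j < m) wvec c Q' x lam j 0 = 1]].
Proof.
apply/seteqP; split=> x.
  move=> xWP; have [w ww xmin] := weakly_pareto_minimizer f_convex c_concave xWP.
  have [lam [wS lamP]] :=
    constraint_qualification_multipliers f_convex c_concave cq ww xmin.
  exists lam; rewrite (wvec_weight Q'K ww.2 wS); split=> //; last 2 first.
  - exact: ww.1.
  - exact: ww.2.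
  by move=> i; have [? ?] := lamP i; split=> //; apply: xmin.1.
move=> [lam [wS lamP w0 w1]].
apply: (stationary_weakly_pareto f_convex c_concave _ _ wS).
- by move=> i; case: (lamP i).
- by split.
- by move=> i; case: (lamP i).
Qed.
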